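(* The only canonical action by a nontrivial finite cyclic group on a simple $3$-dimensional noncommutative torus is the flip action by $\mathbb{Z}_2$. That is, if $\Theta$ is a real skew symmetric $3\times 3$ matrix such that $\mathcal{A}_\Theta$ is simple, and $G\subset G_\Theta$ is a nontrivial finite cyclic subgroup (acting canonically on $\mathcal{A}_\Theta$), then $G=\{I_3,-I_3\}$.
   Context: For a real skew symmetric $d\times d$ matrix $\Theta=(\theta_{kj})$, the noncommutative $d$-torus $\mathcal{A}_\Theta$ is the universal $C^*$-algebra generated by unitaries $u_1,\dots,u_d$ subject to $u_ju_k=\exp(2\pi i\theta_{kj})u_ku_j$. Equivalently, $\mathcal{A}_\Theta=C^*(\mathbb{Z}^d,\omega_\Theta)$ is the twisted group $C^*$-algebra for the 2-cocycle $\omega_\Theta(x,y)=\exp(\pi i\langle\Theta x,y\rangle)$, with canonical unitaries $l_\Theta(x)$, $x\in\mathbb{Z}^d$, satisfying $l_\Theta(x)l_\Theta(y)=\omega_\Theta(x,y)l_\Theta(x+y)$, and $u_i=l_\Theta(e_i)$. Let $G_\Theta:=\{A\in \mathrm{GL}_d(\mathbb{Z}): A^t\Theta A=\Theta\}$. For a subgroup $G\subset G_\Theta$, the canonical action of $G$ on $\mathcal{A}_\Theta$ is $\alpha_A(l_\Theta(x))=l_\Theta(Ax)$ for $A\in G$, $x\in\mathbb{Z}^d$. The flip action is the canonical action of $\mathbb{Z}_2=\{I_d,-I_d\}$, whose generator sends each $l_\Theta(e_i)$ to its adjoint. *)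

(* Defs.v *)
From HB Require Import structures.
From mathcomp Require Import all_boot all_order all_algebra.
From mathcomp Require Import all_classical all_reals all_analysis.
From mathcomp Require Export complex.

Set Implicit Arguments.
Unset Strict Implicit.
Unset Printing Implicit Defensive.

Import Order.TTheory GRing.Theory Num.Theory.

Local Open Scope classical_set_scope.
Local Open Scope complex_scope.
Local Open Scope ring_scope.

(* Unital, nonzero C*-algebras over the complex numbers R[i].  The norm is a
   separate real-valued operation rather than that of a completeNormedModType,
   because the hierarchy forbids joining normed modules with noncommutative
   rings: the only common substructure of pzSemiRingType and
   semiNormedZmodType is numDomainType. *)
HB.mixin Record isCStarAlgebra (R : realType) A
    of GRing.Algebra R[i] A & GRing.NzRing A := {
  cnorm : A -> R ;
  cnorm0_eq0 : forall a : A, cnorm a = 0 -> a = 0 ;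
  ler_cnormD : forall a b : A, cnorm (a + b) <= cnorm a + cnorm b ;
  cnormZ : forall (c : R[i]) (a : A), cnorm (c *: a) = complex.Re `|c| * cnorm a ;
  ler_cnormM : forall a b : A, cnorm (a * b) <= cnorm a * cnorm b ;
  cnorm_complete : forall s : nat -> A,
    (forall e : R, 0 < e -> exists N, forall m n, (N <= m)%N -> (N <= n)%N ->
       cnorm (s m - s n) < e) ->
    exists a : A, forall e : R, 0 < e -> exists N, forall n, (N <= n)%N ->
       cnorm (s n - a) < e ;
  star : A -> A ;
  starK : forall a : A, star (star a) = a ;
  starD : forall a b : A, star (a + b) = star a + star b ;
  starZ : forall (c : R[i]) (a : A), star (c *: a) = c^* *: star a ;
  starM : forall a b : A, star (a * b) = star b * star a ;
  cnorm_star : forall a : A, cnorm (star a * a) = cnorm a ^+ 2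
}.

#[short(type="cstarAlgType")]
HB.structure Definition CStarAlgebra (R : realType) :=
  {A of isCStarAlgebra R A & GRing.Algebra R[i] A & GRing.NzRing A}.

Section CStarNotions.
Variable R : realType.

Definition norm_closed (A : cstarAlgType R) (S : set A) : Prop :=
  forall a : A,
    (forall e : R, 0 < e -> exists2 b, S b & cnorm (b - a) < e) -> S a.

Definition unitary (A : cstarAlgType R) (a : A) : Prop :=
  star a * a = 1 /\ a * star a = 1.

Definition star_morphism (A B : cstarAlgType R) (f : A -> B) : Prop :=
  forall a : A, f (star a) = star (f a).

(* Closure under scalars is automatic since A is unital. *)
Definition two_sided_ideal (A : cstarAlgType R) (I : set A) : Prop :=
  [/\ I 0,
      forall a b : A, I a -> I b -> I (a + b)
    & forall a b : A, I a -> I (b * a) /\ I (a * b)].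

Definition simple_cstar (A : cstarAlgType R) : Prop :=
  forall I : set A, two_sided_ideal I -> norm_closed I -> I = [set 0] \/ I = setT.

Definition unital_star_subalgebra (A : cstarAlgType R) (S : set A) : Prop :=
  [/\ S 1,
      forall (c : R[i]) (a b : A), S a -> S b -> S (c *: a + b),
      forall a b : A, S a -> S b -> S (a * b)
    & forall a : A, S a -> S (star a)].

Definition generates (A : cstarAlgType R) (I : Type) (u : I -> A) : Prop :=
  forall S : set A, unital_star_subalgebra S -> norm_closed S ->
    (forall i, S (u i)) -> S = setT.

(* exp (i t) for real t *)
Definition expi (t : R) : R[i] := cos t +i* sin t.

Variable d : nat.

Definition torus_relations (Theta : 'M[R]_d) (A : cstarAlgType R)
    (u : 'I_d -> A) : Prop :=
  (forall i, unitary (u i)) /\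
  (forall j k, u j * u k = expi (2 * pi * Theta k j) *: (u k * u j)).

(* (A, u) is the universal C*-algebra generated by unitaries u_1, ..., u_d
   subject to the relations of the noncommutative torus of Theta.  This
   determines (A, u) up to a unique *-isomorphism. *)
Definition is_nc_torus (Theta : 'M[R]_d) (A : cstarAlgType R)
    (u : 'I_d -> A) : Prop :=
  [/\ torus_relations Theta u,
      generates u
    & forall (B : cstarAlgType R) (v : 'I_d -> B), torus_relations Theta v ->
        exists phi : {lrmorphism A -> B},
          star_morphism phi /\ forall i, phi (u i) = v i].

Definition pairing (Theta : 'M[R]_d) (x y : 'cV[int]_d) : R :=
  \sum_(i < d) (Theta *m map_mx intr x) i 0 * (y i 0)%:~R.

Definition cocycle (Theta : 'M[R]_d) (x y : 'cV[int]_d) : R[i] :=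
  expi (pi * pairing Theta x y).

(* l is the family of canonical unitaries l_Theta(x), x in Z^d, of the torus
   (A, u); it is uniquely determined by these properties. *)
Definition canonical_unitaries (Theta : 'M[R]_d) (A : cstarAlgType R)
    (u : 'I_d -> A) (l : 'cV[int]_d -> A) : Prop :=
  [/\ forall x, unitary (l x),
      forall x y, l x * l y = cocycle Theta x y *: l (x + y)
    & forall i, l (delta_mx i 0) = u i].

Definition G_Theta (Theta : 'M[R]_d) : set 'M[int]_d :=
  [set A | A \in unitmx /\
           (map_mx intr A)^T *m Theta *m map_mx intr A = Theta].

(* Only the values of alpha on G are relevant. *)
Definition canonical_action (G : set 'M[int]_d) (A : cstarAlgType R)
    (l : 'cV[int]_d -> A) (alpha : 'M[int]_d -> {lrmorphism A -> A}) : Prop :=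
  [/\ forall g, G g -> star_morphism (alpha g),
      forall a, alpha 1%:M a = a,
      forall g h, G g -> G h -> forall a, alpha (g *m h) a = alpha g (alpha h a)
    & forall g, G g -> forall x, alpha g (l x) = l (g *m x)].

End CStarNotions.

Section IntegerMatrixGroups.
Variable d : nat.

Definition subgroup_of (H G : set 'M[int]_d) : Prop :=
  [/\ G `<=` H,
      G 1%:M,
      forall g h, G g -> G h -> G (g *m h)
    & forall g, G g -> G (invmx g)].

Definition cyclic_group (G : set 'M[int]_d) : Prop :=
  exists2 g, G g &
    forall h, G h -> exists n : nat, h = g ^+ n \/ h = invmx g ^+ n.

End IntegerMatrixGroups.

(* Main.v *)
Require Import Defs.
From HB Require Import structures.
From mathcomp Require Import all_boot all_order all_algebra.
From mathcomp Require Import all_classical all_reals all_analysis.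
From mathcomp Require Import ring lra.

Set Implicit Arguments.
Unset Strict Implicit.
Unset Printing Implicit Defensive.

Import Order.TTheory GRing.Theory Num.Theory.

Local Open Scope classical_set_scope.
Local Open Scope ring_scope.

(* A skew symmetric 3 x 3 matrix is Theta = [w]_x, the matrix of the cross
   product with a vector w, and A^t Theta A = Theta means A w = det(A) w.  If
   det(A) = 1 and A <> I has finite order, then A - I has two independent rows:
   otherwise it has rank one and trace det(A) - 1 = 0, so A would be unipotent.
   Both rows are orthogonal to w, hence their cross product p is a nonzero
   integer vector with Theta p = w x p = 0.

   This is impossible when the torus is simple.  The unitary u^p would be
   central, and a central unitary z of a simple C*-algebra is a scalar:
   otherwise all the 1 - w z with |w| = 1 are invertible, uniformly in w by
   compactness, which contradicts Parseval's identity over the roots of unity.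
   But a gauge automorphism sends u^p to - u^p.

   So every A in G with det(A) = 1 is I, and a generator A <> I of G has
   det(A) = -1, whence - A = I. *)

(** * Central unitaries of simple C*-algebras *)

Lemma eq_complexP (R : rcfType) (x y : R[i]) :
  complex.Re x = complex.Re y -> complex.Im x = complex.Im y -> x = y.
Proof. by case: x => a b; case: y => c d /= -> ->. Qed.

(** * Phases on the unit circle *)

Section Expi.
Variable R : realType.

Lemma expi0 : expi 0 = 1 :> R[i].
Proof. by rewrite /expi cos0 sin0. Qed.

Lemma expiD (s t : R) : expi (s + t) = expi s * expi t.
Proof. by apply: eq_complexP; rewrite /= ?cosD ?sinD // addrC. Qed.

Lemma expi_sum (I : Type) (r : seq I) (P : pred I) (F : I -> R) :
  expi (\sum_(i <- r | P i) F i) = \prod_(i <- r | P i) expi (F i).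
Proof. by rewrite (big_morph _ expiD expi0). Qed.

Lemma expiX (t : R) (n : nat) : expi t ^+ n = expi (t * n%:R).
Proof.
elim: n => [|n IH]; first by rewrite mulr0 expi0.
by rewrite exprS IH -expiD -natr1 mulrDr mulr1 addrC.
Qed.

Lemma conj_expi (t : R) : (expi t)^* = expi (- t).
Proof. by rewrite /expi cosN sinN. Qed.

(** Half angles: [cos t = 1 - 2 sin(|t|/2)^2], and the sine is positive strictly between 0 and
    [pi]. *)
Lemma expi_neq1 (t : R) : 0 < `|t| < 2 * pi -> expi t <> 1.
Proof.
move=> /andP[t0 t2] /(congr1 (@complex.Re R)) /=.
have -> : cos t = cos `|t| by case: (ger0P t) => _ //; rewrite cosN.
have -> : `|t| = (`|t| / 2) *+ 2 by rewrite -mulr_natr divfK // pnatr_eq0.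
have : 0 < sin (`|t| / 2) by apply: sin_gt0_pi; lra.
have := cos2Dsin2 (`|t| / 2); rewrite cos_mulr2n; nra.
Qed.

Lemma expi_pi : expi pi = -1 :> R[i].
Proof. by apply: eq_complexP; rewrite /= ?cospi ?sinpi ?oppr0. Qed.

Lemma normc_le_add (z : R[i]) :
  complex.Re `|z| <= `|complex.Re z| + `|complex.Im z|.
Proof.
case: z => a b; rewrite normc_def /= -[leRHS]ger0_norm ?addr_ge0 //.
rewrite -sqrtr_sqr ler_wsqrtr // sqrrD !real_normK ?num_real //.
by rewrite lerD2r lerDl mulrn_wge0 // mulr_ge0.
Qed.

Lemma norm_expi (t : R) : complex.Re `|expi t| = 1.
Proof. by rewrite normc_def /= cos2Dsin2 sqrtr1. Qed.

End Expi.

(** * Norm, adjoint and unitaries *)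

Section CNorm.
Variables (R : realType) (A : cstarAlgType R).
Implicit Types a b x : A.

Lemma cnorm0 : cnorm (0 : A) = 0 :> R.
Proof. by rewrite -(scale0r (0 : A)) cnormZ normr0 mul0r. Qed.

Lemma cnormN a : cnorm (- a) = cnorm a.
Proof. by rewrite -scaleN1r cnormZ normrN1 mul1r. Qed.

Lemma cnorm_ge0 a : 0 <= cnorm a.
Proof.
have := ler_cnormD a (- a); rewrite subrr cnorm0 cnormN; lra.
Qed.

Lemma cnorm_distC a b : cnorm (a - b) = cnorm (b - a).
Proof. by rewrite -cnormN opprB. Qed.

Lemma cnorm_sum (I : Type) (r : seq I) (F : I -> A) :
  cnorm (\sum_(i <- r) F i) <= \sum_(i <- r) cnorm (F i).
Proof.
elim/big_ind2: _ => [|a x b y ax by_|//]; first by rewrite cnorm0.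
by apply: le_trans (ler_cnormD _ _) _; exact: lerD.
Qed.

Lemma cnorm_natZ (n : nat) a : cnorm (n%:R *: a) = n%:R * cnorm a.
Proof. by rewrite cnormZ normr_nat raddfMn. Qed.

Lemma cnorm_expiZ (t : R) a : cnorm (expi t *: a) = cnorm a.
Proof. by rewrite cnormZ norm_expi mul1r. Qed.

Lemma star0 : star (0 : A) = 0.
Proof. by apply: (addrI (star 0)); rewrite -starD !addr0. Qed.

Lemma star1 : star (1 : A) = 1.
Proof. by rewrite -[RHS]starK -[star 1 in RHS]mulr1 starM starK mulr1. Qed.

Lemma star_sum (I : Type) (r : seq I) (F : I -> A) :
  star (\sum_(i <- r) F i) = \sum_(i <- r) star (F i).
Proof. exact: (big_morph _ (@starD R A) star0). Qed.

Lemma starX a (n : nat) : star (a ^+ n) = star a ^+ n.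
Proof. by elim: n => [|n IH]; rewrite ?star1 // exprS starM IH -exprSr. Qed.

Lemma cnorm1 : cnorm (1 : A) = 1.
Proof.
have := cnorm_star (1 : A); rewrite star1 mulr1 expr2 => E.
apply: (@mulIf _ (cnorm (1 : A))); last by rewrite mul1r -E.
by apply/eqP => /cnorm0_eq0/eqP; rewrite oner_eq0.
Qed.

Lemma unitary_cnorm a : unitary a -> cnorm a = 1.
Proof.
move=> [aa _]; have := cnorm_star a; rewrite aa cnorm1 => /esym/eqP.
by rewrite sqrf_eq1 => /predU1P[//|/eqP E]; have := cnorm_ge0 a; rewrite E; lra.
Qed.

Lemma unitaryX a (n : nat) : unitary a -> unitary (a ^+ n).
Proof.
move=> [sa as_]; rewrite /unitary starX; have C : GRing.comm a (star a).
  by rewrite /GRing.comm sa.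
by rewrite -!exprMn_comm ?sa ?as_ ?expr1n //; apply: commr_sym.
Qed.

Lemma unitaryM a b : unitary a -> unitary b -> unitary (a * b).
Proof.
move=> [a1 a2] [b1 b2]; split; rewrite starM mulrA.
  by rewrite -(mulrA _ _ a) a1 mulr1.
by rewrite -(mulrA _ b) b2 mulr1.
Qed.

Lemma unitary_star a : unitary a -> unitary (star a).
Proof. by move=> [a1 a2]; split; rewrite starK. Qed.

End CNorm.

(** As [y] is central, the closure [I] of [y A] is a closed ideal; it contains [y], so it is all of
    [A]. Some [b] then has [y b] within 1/2 of 1, and [x = b (y x) - (y b - 1) x] lets half of the
    norm of [x] be absorbed. *)
Lemma simple_central_bounded_below (R : realType) (A : cstarAlgType R) (y : A) :
  simple_cstar A -> (forall a, y * a = a * y) -> y <> 0 ->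
  exists2 C : R, 0 < C & forall x, cnorm x <= C * cnorm (y * x).
Proof.
move=> simA yC y0.
pose I := [set a : A | forall e : R, 0 < e -> exists b, cnorm (y * b - a) < e].
have idI : two_sided_ideal I.
  have closeM (a c b : A) : cnorm (y * (b * c) - a * c) <= cnorm (y * b - a) * cnorm c.
    by rewrite mulrA -mulrBl ler_cnormM.
  have smallM (c : A) (e : R) : 0 < e -> exists2 e', 0 < e' & e' * cnorm c < e.
    (* The added 1 covers the case [c = 0]. *)
    move=> e0; have c1 : 0 < cnorm c + 1 by rewrite ltr_wpDl ?cnorm_ge0.
    exists (e / (cnorm c + 1)); first exact: divr_gt0.
    by rewrite mulrAC ltr_pdivrMr // ltr_pM2l // ltrDl.
  split.
  - by move=> e e0; exists 0; rewrite mulr0 subrr cnorm0.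
  - move=> a b Ia Ib e e0.
    have e20 : 0 < e / 2 by lra.
    have [a' a'P] := Ia _ e20; have [b' b'P] := Ib _ e20.
    exists (a' + b'); rewrite mulrDr opprD addrACA.
    by apply: le_lt_trans (ler_cnormD _ _) _; lra.
  - move=> a c Ia; split=> e /(smallM c)[e' e'0 e'e].
      have [b bP] := Ia _ e'0; exists (c * b).
      rewrite mulrA yC -mulrA -mulrBr.
      apply: le_lt_trans (ler_cnormM _ _) _; apply: le_lt_trans e'e.
      by rewrite mulrC ler_wpM2r ?cnorm_ge0 // ltW.
    have [b bP] := Ia _ e'0; exists (b * c).
    apply: le_lt_trans (closeM _ _ _) _; apply: le_lt_trans e'e.
    by rewrite ler_wpM2r ?cnorm_ge0 // ltW.
have clI : norm_closed I.
  move=> a aP e e0; have e20 : 0 < e / 2 by lra.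
  have [b Ib ba] := aP _ e20; have [c cb] := Ib _ e20; exists c.
  rewrite -(subrKA b); apply: le_lt_trans (ler_cnormD _ _) _; lra.
have Iy : I y by move=> e e0; exists 1; rewrite mulr1 subrr cnorm0.
have [I0|IT] := simA I idI clI.
  by case: y0; move: Iy; rewrite I0.
have I1 : I 1 by rewrite IT.
have [|b yb1] := I1 2^-1; first by rewrite invr_gt0.
exists (2 * cnorm b + 1) => [|x]; first by have := cnorm_ge0 b; lra.
have := ler_cnormD (b * (y * x)) (- ((y * b - 1) * x)).
rewrite [_ + _](_ : _ = x); last by rewrite mulrBl mul1r mulrA -yC opprB addrC subrK.
have := ler_cnormM b (y * x).
have := ler_wpM2r (cnorm_ge0 x) (ltW yb1).
have := ler_cnormM (y * b - 1) x; have := cnorm_ge0 (y * x).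
rewrite cnormN; nra.
Qed.

(* A lower bound for [1 - expi t *: z] survives a small change of [t], with
   twice the constant, so the compactness of the circle makes it uniform. *)
Lemma uniform_bounded_below (R : realType) (A : cstarAlgType R) (z : A) :
  unitary z ->
  (forall t : R, exists2 C : R, 0 < C &
     forall x, cnorm x <= C * cnorm ((1 - expi t *: z) * x)) ->
  exists C : R, forall t : R, 0 <= t <= 2 * pi ->
     forall x, cnorm x <= C * cnorm ((1 - expi t *: z) * x).
Proof.
move=> zu bnd.
pose P (C t : R) := forall x, cnorm x <= C * cnorm ((1 - expi t *: z) * x).

have cpt : near_covering `[0, 2 * pi : R]%classic.
  by apply/compact_near_coveringP; exact: segment_compact.
have bounded : forall t, `[0, 2 * pi : R]%classic t -> \forall s \near t & D \near +oo, P D s.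
  move=> t _; have [C C0 Ct] := bnd t.
  (* Real and imaginary parts each move by less than [1/(4C)], so [expi] moves by at most [1/(2C)],
     and the perturbation costs at most half of the norm of [x]. *)
  have d0 : 0 < (4 * C)^-1 by rewrite invr_gt0; lra.
  have cosn : \forall s \near t, `|cos t - cos s| < (4 * C)^-1.
    by have /cvgrPdist_lt/(_ _ d0) := @continuous_cos R t.
  have sinn : \forall s \near t, `|sin t - sin s| < (4 * C)^-1.
    by have /cvgrPdist_lt/(_ _ d0) := @continuous_sin R t.
  exists ([set s | `|cos t - cos s| < (4 * C)^-1 /\ `|sin t - sin s| < (4 * C)^-1],
          [set D | 2 * C <= D]).
    by split; [exact: filterI | by apply: nbhs_pinfty_ge; rewrite num_real].
  move=> [s D] [[/= cosn' sinn'] CD] x.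
  have tsC : complex.Re `|expi s - expi t| * C <= 2^-1.
    rewrite -ler_pdivlMr // -invfM.
    apply: le_trans (normc_le_add _) _ => /=; rewrite (distrC (cos s)) (distrC (sin s)).
    apply: le_trans (lerD (ltW cosn') (ltW sinn')) _.
    by rewrite le_eqVlt; apply/orP; left; apply/eqP; field; rewrite gt_eqF.
  have := Ct x.
  have -> : (1 - expi t *: z) * x =
            (1 - expi s *: z) * x + (expi s - expi t) *: (z * x).
    by rewrite !mulrBl mul1r !scalerAl [in RHS]scalerBl mulrBl addrA subrK.
  have := ler_cnormD ((1 - expi s *: z) * x) ((expi s - expi t) *: (z * x)).
  have := ler_cnormM z x; rewrite (unitary_cnorm zu) mul1r cnormZ.
  set a := cnorm x; set b := cnorm ((1 - expi s *: z) * x).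
  set c := cnorm (_ + _); set d := cnorm (z * x); set e := complex.Re _ in tsC |- *.
  have e0 : 0 <= e by rewrite /e normc_def /= sqrtr_ge0.
  have b0 : 0 <= b by exact: cnorm_ge0.
  move=> da cb ac.
  have eda : C * (e * d) <= 2^-1 * a.
    by rewrite mulrA (mulrC C); apply: ler_pM => //; [rewrite mulr_ge0 // ltW| exact: cnorm_ge0].
  have : C * c <= C * b + C * (e * d) by rewrite -mulrDr ler_pM2l.
  have : 2 * C * b <= D * b by rewrite ler_wpM2r.
  lra.
have [M [Mreal MP]] := cpt _ _ _ _ bounded.
(* The bound is known for constants strictly above [M]. *)
exists (M + 1) => t t02; apply: (MP (M + 1)); first by rewrite ltrDl.
by rewrite /= in_itv.
Qed.

(** For [m != n] this is a geometric sum whose ratio is an [N]-th root of unity, distinct from 1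
    because [0 < |n - m| < N]. *)
Lemma sum_roots_of_unity (R : realType) (N m n : nat) : (m < N)%N -> (n < N)%N ->
  \sum_(k < N) expi (2 * pi / N%:R * k%:R * (n%:R - m%:R)) =
  (if m == n then N%:R else 0) :> R[i].
Proof.
move=> mN nN; have N0 : 0 < N%:R :> R by rewrite ltr0n (leq_ltn_trans _ mN).
have [->|mn] := eqVneq m n.
  rewrite (eq_bigr (fun=> 1)) ?sumr_const ?card_ord // => k _.
  by rewrite subrr mulr0 expi0.
set t := 2 * pi / N%:R * (n%:R - m%:R) : R.
rewrite (eq_bigr (fun k : 'I_N => expi t ^+ k)) => [|k _]; last first.
  by rewrite expiX; congr expi; rewrite /t; ring.
have tN : expi t ^+ N = 1.
  rewrite expiX (_ : t * N%:R = 2 * pi * n%:R - 2 * pi * m%:R); last first.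
    by rewrite /t; field; rewrite gt_eqF.
  have tk k : expi (2 * pi * k%:R) = 1 :> R[i].
    by rewrite -expiX mulr2n mulrDl mul1r expiD expi_pi mulrNN mulr1 expr1n.
  by rewrite expiD -[expi (- _)]mul1r -{1}(tk m) -expiD subrr expi0 mulr1 tk.
apply/(mulfI (x := expi t - 1)); last by rewrite -subrX1 tN subrr mulr0.
rewrite subr_eq0; apply/eqP/expi_neq1.
have pi0 := pi_gt0 R.
have nm0 : 0 < `|n%:R - m%:R| :> R by rewrite normr_gt0 subr_eq0 eqr_nat eq_sym.
have nmN : `|n%:R - m%:R| < N%:R :> R.
  rewrite ltr_norml; move: mN nN; rewrite -!(ltr_nat R) => mN nN.
  have := ler0n R m; have := ler0n R n; lra.
rewrite /t normrM (ger0_norm (x := _ / _)); last by apply: divr_ge0; lra.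
rewrite mulr_gt0 ?divr_gt0 //=; last lra.
by rewrite mulrAC ltr_pdivrMr // ltr_pM2l //; lra.
Qed.

(* Parseval over the [N]-th roots of unity: with [P_w = \sum_(n < N) w^n z^n],
   the elements [P_w^* P_w] sum up to [N^2], while [(1 - w z) P_w = 1 - z^N]
   bounds each [P_w]. *)
Lemma not_uniform_bounded_below (R : realType) (A : cstarAlgType R) (z : A) (C : R) :
  unitary z ->
  ~ forall t : R, 0 <= t <= 2 * pi ->
     forall x, cnorm x <= C * cnorm ((1 - expi t *: z) * x).
Proof.
move=> zu bnd.
have C0 : 0 <= C.
  have := bnd 0; rewrite lexx mulr_ge0 ?pi_ge0 // => /(_ isT 1).
  rewrite cnorm1; have := cnorm_ge0 ((1 - expi 0 *: z) * 1).
  set c := cnorm _; nra.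
(* Parseval will give [N^2 <= N (2C)^2], which this choice of [N] refutes. *)
pose N := (Num.truncn ((2 * C) ^+ 2)).+1.
have NC : (2 * C) ^+ 2 < N%:R by apply: truncnS_gt.
have N0 : 0 < N%:R :> R by rewrite ltr0n.
pose th (k : 'I_N) : R := 2 * pi / N%:R * k%:R.
pose P (k : 'I_N) := \sum_(n < N) (expi (th k) *: z) ^+ n.
have Pbound k : cnorm (P k) <= 2 * C.
  apply: le_trans (bnd (th k) _ _) _.
    rewrite mulr_ge0 ?divr_ge0 ?mulr_ge0 ?pi_ge0 //=.
    rewrite /th mulrAC ler_pdivrMr // ler_pM2l ?mulr_gt0 ?pi_gt0 //.
    by rewrite ler_nat ltnW.
  rewrite mulrC ler_wpM2r //.
  have -> : (1 - expi (th k) *: z) * P k = 1 - (expi (th k) *: z) ^+ N.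
    by rewrite -[LHS]opprK -mulNr opprB -subrX1 opprB.
  apply: le_trans (ler_cnormD _ _) _.
  rewrite cnormN cnorm1 exprZn expiX cnorm_expiZ (unitary_cnorm (unitaryX _ zu)).
  lra.
have PP : \sum_k star (P k) * P k = (N%:R * N%:R) *: 1.
  transitivity (\sum_(m < N) \sum_(n < N) \sum_(k < N)
      expi (th k * (n%:R - m%:R)) *: (star z ^+ m * z ^+ n)).
    under [RHS]eq_bigr do rewrite exchange_big.
    rewrite [RHS]exchange_big; apply: eq_bigr => k _.
    rewrite star_sum big_distrlr; apply: eq_bigr => m _; apply: eq_bigr => n _ /=.
    rewrite starX starZ conj_expi !exprZn !expiX -scalerAl -scalerAr scalerA -expiD.
    by congr (expi _ *: _); ring.
  (* Summing over [k] kills the terms with [m != n]; on the diagonal, unitarity leaves 1. *)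
  transitivity (\sum_(m < N) N%:R *: (1 : A)).
    apply: eq_bigr => m _; rewrite (bigD1 m) //= -scaler_suml sum_roots_of_unity //.
    rewrite eqxx -exprMn_comm; last by rewrite /GRing.comm zu.1 zu.2.
    rewrite zu.1 expr1n big1 ?addr0 // => n nm.
    by rewrite -scaler_suml sum_roots_of_unity // eq_sym (_ : (n == m :> nat) = false) ?scale0r //; exact: negPf.
  by rewrite sumr_const card_ord -scaler_nat scalerA.
have : cnorm (\sum_k star (P k) * P k) <= N%:R * (2 * C) ^+ 2.
  apply: le_trans (cnorm_sum _ _) _.
  rewrite mulr_natl -[in leRHS](card_ord N) -sumr_const; apply: ler_sum => k _.
  by rewrite cnorm_star lerXn2r ?nnegrE ?cnorm_ge0 ?mulr_ge0.
rewrite PP -natrM cnorm_natZ cnorm1 mulr1 natrM ler_pM2l //.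
by rewrite leNgt NC.
Qed.

(** If [z] is no such scalar, every [1 - expi t *: z] is central and nonzero, hence bounded below;
    the two preceding lemmas then clash. *)
Lemma simple_central_unitary_scalar (R : realType) (A : cstarAlgType R) (z : A) :
  simple_cstar A -> unitary z -> (forall a, z * a = a * z) ->
  exists t : R, z = expi t *: 1.
Proof.
move=> simA zu zC; apply: contrapT => nz.
have [|C] := uniform_bounded_below zu; last exact: not_uniform_bounded_below.
move=> t; apply: simple_central_bounded_below => //.
  by move=> a; rewrite mulrBl mulrBr mul1r mulr1 -scalerAl -scalerAr zC.
move/eqP; rewrite subr_eq0 => /eqP E; apply: nz; exists (- t).
by rewrite E scalerA -expiD addNr expi0 scale1r.
Qed.

(** * Monomials in the generators of a noncommutative torus *)

Section Monomials.
Variables (R : realType) (A : cstarAlgType R).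
Implicit Types a b : A.

(** Integer power of a unitary, whose inverse is its adjoint; [Negz k] is [-(k+1)]. *)
Definition upow a (n : int) : A :=
  match n with Posz k => a ^+ k | Negz k => star a ^+ k.+1 end.

Lemma upow_unitary a (n : int) : unitary a -> unitary (upow a n).
Proof. by case: n => k ua; apply: unitaryX => //; apply: unitary_star. Qed.

Lemma expi_commX a b (t : R) (n : nat) : a * b = expi t *: (b * a) ->
  a * b ^+ n = expi (t * n%:R) *: (b ^+ n * a).
Proof.
move=> ab; elim: n => [|n IH]; first by rewrite mulr0 expi0 scale1r mulr1 mul1r.
rewrite exprSr mulrA IH -scalerAl -(mulrA _ a b) ab -scalerAr scalerA -expiD mulrA.
by rewrite -natr1 mulrDr mulr1.
Qed.

Lemma upow_comm a b (t : R) (n : int) : unitary b -> a * b = expi t *: (b * a) ->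
  a * upow b n = expi (t * n%:~R) *: (upow b n * a).
Proof.
move=> [sbb bsb] ab; case: n => k; first exact: expi_commX.
rewrite (_ : t * _ = - t * k.+1%:R); last by rewrite mulNr -mulrN.
apply: expi_commX.
(* Multiplying the relation by [star b] on both sides shows that passing [star b] costs the opposite
   phase. *)
have : star b * a = expi t *: (a * star b).
  by rewrite -[LHS]mulr1 -bsb mulrA -(mulrA _ a b) ab -scalerAr mulrA sbb mul1r -scalerAl.
by move=> ->; rewrite scalerA -expiD addNr expi0 scale1r.
Qed.

Lemma upow_expiZ a (t : R) (n : int) :
  upow (expi t *: a) n = expi (t * n%:~R) *: upow a n.
Proof.
case: n => k /=; first by rewrite exprZn expiX.
by rewrite starZ conj_expi exprZn expiX mulNr -mulrN.
Qed.

Lemma unitary_expiZ a (t : R) : unitary a -> unitary (expi t *: a).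
Proof.
move=> [sa as_]; rewrite /unitary starZ conj_expi -!scalerAl -!scalerAr !scalerA.
by rewrite -!expiD addNr subrr expi0 !scale1r.
Qed.

Definition monomial d (u : 'I_d -> A) (p : 'cV[int]_d) : A :=
  \prod_i upow (u i) (p i 0).

Lemma monomial_unitary d (u : 'I_d -> A) (p : 'cV[int]_d) :
  (forall i, unitary (u i)) -> unitary (monomial u p).
Proof.
move=> uu; rewrite /monomial; elim/big_ind: _ => [||i _]; last exact: upow_unitary.
- by rewrite /unitary star1 mulr1.
- by move=> a b; exact: unitaryM.
Qed.

Lemma monomial_comm d (u : 'I_d -> A) (p : 'cV[int]_d) a (t : 'I_d -> R) :
  (forall i, unitary (u i)) -> (forall i, a * u i = expi (t i) *: (u i * a)) ->
  a * monomial u p = expi (\sum_i t i * (p i 0)%:~R) *: (monomial u p * a).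
Proof.
move=> uu au; rewrite /monomial.
elim/big_rec2: _ => [|i b s _ IH]; first by rewrite expi0 scale1r mulr1 mul1r.
rewrite mulrA (upow_comm _ (uu i) (au i)) -scalerAl -(mulrA _ a) IH -scalerAr scalerA.
by rewrite -expiD mulrA.
Qed.

Lemma monomial_expiZ d (u : 'I_d -> A) (p : 'cV[int]_d) (t : 'I_d -> R) :
  monomial (fun i => expi (t i) *: u i) p =
  expi (\sum_i t i * (p i 0)%:~R) *: monomial u p.
Proof.
rewrite /monomial expi_sum -scaler_prod.
by apply: eq_bigr => i _; rewrite upow_expiZ.
Qed.

End Monomials.

Lemma monomial_morph (R : realType) (A B : cstarAlgType R)
    (phi : {lrmorphism A -> B}) d (u : 'I_d -> A) (p : 'cV[int]_d) :
  star_morphism phi -> phi (monomial u p) = monomial (phi \o u) p.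
Proof.
move=> phiS; rewrite rmorph_prod; apply: eq_bigr => i _ /=.
by case: (p i 0) => k /=; rewrite rmorphXn //= phiS.
Qed.

(** The commutant of [z] is a norm-closed unital subalgebra, stable under [star] because [z] is
    unitary. *)
Lemma generates_central (R : realType) (A : cstarAlgType R) (I : Type) (u : I -> A)
    (z : A) :
  generates u -> unitary z -> (forall i, z * u i = u i * z) ->
  forall a, z * a = a * z.
Proof.
move=> gen uz zu a; have [szz zsz] := uz.
suff : [set a | z * a = a * z] = setT by move/seteqP => [_ /(_ a)]; exact.
apply: gen => //.
- split => /=; first by rewrite mulr1 mul1r.
  + by move=> c x y zx zy; rewrite mulrDr mulrDl -scalerAr -scalerAl zx zy.
  + by move=> x y zx zy; rewrite mulrA zx -mulrA zy mulrA.
  + move=> x zx; apply: (can_inj (@starK R A)); rewrite !starM starK.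
    by rewrite -[RHS]mulr1 -zsz -mulrA (mulrA x) -zx !mulrA szz mul1r.
- move=> x xP /=; apply/eqP; rewrite -subr_eq0; apply/eqP/cnorm0_eq0.
  apply/eqP; rewrite eq_le cnorm_ge0 andbT; apply/ler_addgt0Pr => e e0.
  have [|b bz bx] := xP (e / 2); first lra.
  rewrite add0r (_ : z * x - x * z = z * (x - b) + (b - x) * z); last first.
    by rewrite mulrBr mulrBl bz addrA subrK.
  apply: le_trans (ler_cnormD _ _) _.
  have := ler_cnormM z (x - b); have := ler_cnormM (b - x) z.
  rewrite (unitary_cnorm uz) mul1r mulr1 (cnorm_distC x); lra.
Qed.

(* The monomial [u^p] is central, hence scalar by simplicity, but the gauge
   automorphism rotating the [u_i] by suitable phases maps it to its opposite. *)
Lemma simple_nc_torus_nondegenerate (R : realType) (d : nat) (Theta : 'M[R]_d)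
    (A : cstarAlgType R) (u : 'I_d -> A) (p : 'cV[int]_d) :
  Theta^T = - Theta -> is_nc_torus Theta u -> simple_cstar A ->
  Theta *m map_mx intr p = 0 -> p = 0.
Proof.
move=> skew [[uu ucomm] gen univ] simA Thetap.
apply/eqP; apply: contrapT => /negP p0.
have [i pi0] : exists i, p i 0 != 0.
  by apply/existsP; apply: contraNT p0 => /existsPn p0; apply/eqP/matrixP => i j;
     rewrite ord1 mxE; apply/eqP/negPn/p0.
have zuni := monomial_unitary p uu.
set z := monomial u p in zuni.
have zC : forall a, z * a = a * z.
  apply: (generates_central gen zuni) => j.
  rewrite (monomial_comm _ uu (fun k => ucomm j k)) (_ : \sum_i _ = 0).
    by rewrite expi0 scale1r.
  (* By skew symmetry, the phase from moving [u j] past [u^p] is a multiple of [(Theta p)_j]. *)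
  transitivity (- (2 * pi) * (Theta *m map_mx intr p) j 0).
    rewrite mxE mulr_sumr; apply: eq_bigr => k _; rewrite mxE.
    by move/matrixP: skew => /(_ j k); rewrite !mxE => ->; ring.
  by rewrite Thetap mxE mulr0.
have [t zt] := simple_central_unitary_scalar simA zuni zC.
(* Only [u i] is rotated, so that its power [p i 0] picks up [expi pi = -1]. *)
pose th (j : 'I_d) : R := if j == i then pi / (p i 0)%:~R else 0.
have [|phi [phiS phiu]] := univ A (fun j => expi (th j) *: u j).
  split=> [j|j k]; first exact: unitary_expiZ.
  rewrite -!scalerAl -!scalerAr ucomm !scalerA; congr (_ *: _); ring.
have : phi z = - z.
  rewrite monomial_morph // (_ : phi \o u = fun j => expi (th j) *: u j).
    rewrite monomial_expiZ (bigD1 i) //= big1 => [|j ji].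
      by rewrite addr0 /th eqxx divfK ?intr_eq0 // expi_pi scaleN1r.
    by rewrite /th (negPf ji) mul0r.
  by apply/funext => j /=; exact: phiu.
(* [phi] fixes the scalar [z], so [z = - z], although [z] has norm 1. *)
rewrite {1}zt linearZ /= rmorph1 -zt => zz.
have := unitary_cnorm zuni.
rewrite (_ : z = 0) ?cnorm0 => [/esym/eqP|]; first by rewrite oner_eq0.
apply: (scalerI (a := 2%:R : R[i])); first by rewrite pnatr_eq0.
by rewrite scaler0 scaler_nat mulr2n {1}zz addNr.
Qed.

(** * Canonical unitaries and the flip *)

Lemma pairing_self (R : realType) (d : nat) (Theta : 'M[R]_d) (x : 'cV[int]_d) :
  Theta^T = - Theta -> pairing Theta x x = 0.
Proof.
move=> skew; pose S := (map_mx intr x)^T *m (Theta *m map_mx intr x).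
have -> : pairing Theta x x = S 0 0.
  by rewrite mxE; apply: eq_bigr => i _; rewrite 2![in RHS]mxE mulrC.
have : S^T = - S.
  by rewrite /S !trmx_mul trmxK skew -mulmxA mulNmx mulmxN.
move/matrixP/(_ 0 0); rewrite !mxE; lra.
Qed.

(** The cocycle is trivial on [x] and [- x], and [l 0] is an idempotent unitary, hence 1; so
    [l (- x)] inverts [l x]. *)
Lemma canonical_unitaryN (R : realType) (d : nat) (Theta : 'M[R]_d)
    (A : cstarAlgType R) (u : 'I_d -> A) (l : 'cV[int]_d -> A) (x : 'cV[int]_d) :
  Theta^T = - Theta -> canonical_unitaries Theta u l -> l (- x) = star (l x).
Proof.
move=> skew [lu lM _].
have p0 y : pairing Theta y (- y) = 0.
  rewrite -oppr0 -(pairing_self y skew) /pairing -sumrN.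
  by apply: eq_bigr => i _; rewrite [X in _ * X%:~R]mxE mulrNz mulrN.
have llN y : l y * l (- y) = l 0.
  by rewrite lM /cocycle p0 mulr0 expi0 scale1r subrr.
have l0 : l 0 = 1.
  have [s0 _] := lu 0.
  by have := llN 0; rewrite oppr0 => l00; rewrite -[LHS]mul1r -s0 -mulrA l00.
by have [sx _] := lu x; rewrite -[LHS]mul1r -sx -mulrA llN l0 mulr1.
Qed.

(** * Finite order integer matrices preserving a skew form *)

(** The vanishing of all 2 x 2 minors encodes rank at most one; it turns [M i k * M k l] into
    [M i l * M k k]. *)
Lemma minors0_sqr (R : comNzRingType) (n : nat) (M : 'M[R]_n) :
  (forall i j k l, M i k * M j l = M i l * M j k) -> M *m M = \tr M *: M.
Proof.
move=> M0; apply/matrixP => i l; rewrite !mxE mulrC big_distrr /=.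
by apply: eq_bigr => k _; rewrite M0 mulrC.
Qed.

(** * Determinants and cross products in dimension three *)

Lemma matrix_nat_entries (R : Type) (m n : nat) (M : 'M[R]_(m.+1, n.+1)) :
  exists f : nat -> nat -> R, M = \matrix_(i, j) f i j.
Proof.
exists (fun i j => M (inord i) (inord j)).
by apply/matrixP => i j; rewrite mxE !inord_val.
Qed.

Lemma det_mx33 (R : comNzRingType) (M : 'M[R]_3) :
  \det M = M 0 0 * (M 1 1 * M 2 2 - M 1 2 * M 2 1)
         - M 0 1 * (M 1 0 * M 2 2 - M 1 2 * M 2 0)
         + M 0 2 * (M 1 0 * M 2 1 - M 1 1 * M 2 0).
Proof.
(* With entries indexed by naturals, the ordinals produced by cofactor expansion reduce to
   numerals. *)
have [f ->] := matrix_nat_entries M.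
do 2 rewrite !(expand_det_row _ 0) /cofactor !big_ord_recl !big_ord0.
rewrite /cofactor !det_mx11 !mxE /= /bump /=.
rewrite !addnE /= !modn_def /=; ring.
Qed.

Lemma big_I3 (R : nmodType) (F : 'I_3 -> R) : \sum_i F i = F 0 + F 1 + F 2.
Proof.
rewrite !big_ord_recl big_ord0 addr0 addrA.
by do ![congr (_ + _)]; congr F; apply: val_inj.
Qed.

Lemma forall_I3 (P : 'I_3 -> Prop) : P 0 -> P 1 -> P 2 -> forall i, P i.
Proof.
move=> P0 P1 P2 [[|[|[|//]]] lti3].
- by rewrite (_ : Ordinal lti3 = 0) //; apply: val_inj.
- by rewrite (_ : Ordinal lti3 = 1) //; apply: val_inj.
- by rewrite (_ : Ordinal lti3 = 2) //; apply: val_inj.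
Qed.

Lemma minors0_det (R : comNzRingType) (M : 'M[R]_3) :
  (forall i j k l, M i k * M j l = M i l * M j k) -> \det (1%:M + M) = 1 + \tr M.
Proof.
move=> M0; rewrite det_mx33 /mxtrace big_I3 !mxE /=.
(* Regrouped so that every term beyond [1 + \tr M] contains a 2 x 2 minor. *)
transitivity (1 + (M 0 0 + M 1 1 + M 2 2) + (M 0 0 * M 1 1 - M 0 1 * M 1 0)
  + (M 0 0 * M 2 2 - M 0 2 * M 2 0)
  + (1 + M 0 0) * (M 1 1 * M 2 2 - M 1 2 * M 2 1)
  - M 0 1 * (M 1 0 * M 2 2 - M 1 2 * M 2 0)
  + M 0 2 * (M 1 0 * M 2 1 - M 1 1 * M 2 0)); first by ring.
rewrite (M0 0 1 0 1) (M0 0 2 0 2) (M0 1 2 1 2) (M0 1 2 0 2) (M0 1 2 0 1).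
by rewrite !subrr !mulr0 subr0 !addr0.
Qed.

(* [crossmx w *m v] is the cross product of [w] and [v]. *)
Definition crossmx (R : nzRingType) (w : 'cV[R]_3) : 'M[R]_3 :=
  \matrix_(i, j)
    nth 0 (nth [::] [:: [:: 0; - w 2 0; w 1 0];
                       [:: w 2 0; 0; - w 0 0];
                       [:: - w 1 0; w 0 0; 0]] i) j.

Lemma crossmx_inj (R : nzRingType) : injective (@crossmx R).
Proof.
move=> v w vw; apply/matrixP => i j; rewrite ord1.
elim/forall_I3: i.
- by move/matrixP: vw => /(_ 2 1); rewrite !mxE.
- by move/matrixP: vw => /(_ 0 2); rewrite !mxE.
- by move/matrixP: vw => /(_ 1 0); rewrite !mxE.
Qed.

Lemma skew_crossmx (R : numFieldType) (Theta : 'M[R]_3) :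
  Theta^T = - Theta -> exists w, Theta = crossmx w.
Proof.
move=> skew.
have E i j : Theta j i = - Theta i j by move/matrixP: skew => /(_ i j); rewrite !mxE.
have D i : Theta i i = 0.
  by apply/eqP; rewrite -[_ == _](mulrn_eq0 _ 2) mulr2n {1}E addNr.
exists (\col_i nth 0 [:: Theta 2 1; Theta 0 2; Theta 1 0] i).
apply/matrixP => i j; rewrite !mxE.
by elim/forall_I3: i; elim/forall_I3: j => /=; rewrite ?D // E.
Qed.

(** Matrix form of [g^T (g w x g v) = det(g) (w x v)]; it converts invariance of the form into a
    condition on [g w]. *)
Lemma crossmx_conj (R : comNzRingType) (g : 'M[R]_3) (w : 'cV[R]_3) :
  g^T *m crossmx (g *m w) *m g = \det g *: crossmx w.
Proof.
apply/matrixP => i j; rewrite det_mx33; do 4 ?rewrite ?mxE ?big_I3 /=.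
elim/forall_I3: i; elim/forall_I3: j => /=; ring.
Qed.

(** Lagrange's formula for [w x (r x s)], which vanishes once [w] is orthogonal to [r] and [s]. *)
Lemma crossmx_triple (R : comNzRingType) (w r s : 'cV[R]_3) :
  crossmx w *m (crossmx r *m s) = (s^T *m w) 0 0 *: r - (r^T *m w) 0 0 *: s.
Proof.
apply/matrixP => i j; rewrite ord1; do 4 ?rewrite ?mxE ?big_I3 /=.
elim/forall_I3: i => /=; ring.
Qed.

Lemma map_crossmx (R S : nzRingType) (f : {rmorphism R -> S}) (w : 'cV[R]_3) :
  map_mx f (crossmx w) = crossmx (map_mx f w).
Proof.
apply/matrixP => i j; rewrite !mxE.
by elim/forall_I3: i; elim/forall_I3: j => /=; rewrite ?rmorphN ?rmorph0.
Qed.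

Lemma crossmx_eq0 (R : comNzRingType) (r s : 'cV[R]_3) :
  crossmx r *m s = 0 -> forall k l, r k 0 * s l 0 = r l 0 * s k 0.
Proof.
move=> rs0 k l; have E i : (crossmx r *m s) i 0 = 0 by rewrite rs0 mxE.
move: (E 0) (E 1) (E 2); rewrite !mxE !big_I3 !mxE /= => E0 E1 E2.
apply/eqP; rewrite -subr_eq0; apply/eqP.
elim/forall_I3: k; elim/forall_I3: l; rewrite ?(mulrC (r _ _)) ?subrr //;
  first [ rewrite -[RHS]E0; ring | rewrite -[RHS]E1; ring | rewrite -[RHS]E2; ring
        | apply: oppr_inj; rewrite oppr0 -[RHS]E0; ring
        | apply: oppr_inj; rewrite oppr0 -[RHS]E1; ring
        | apply: oppr_inj; rewrite oppr0 -[RHS]E2; ring ].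
Qed.

(** With [N = g - 1] of square zero, [g ^+ m = 1 + m N]; so [k N = 0], and the integers are
    torsion-free. *)
Lemma unipotent_finite_order (n k : nat) (g : 'M[int]_n.+1) :
  (0 < k)%N -> g ^+ k = 1 -> (g - 1) * (g - 1) = 0 -> g = 1.
Proof.
move=> k0 gk NN; apply/eqP; rewrite -subr_eq0.
have gE m : g ^+ m = 1 + (g - 1) *+ m.
  elim: m => [|m IH]; first by rewrite expr0 mulr0n addr0.
  rewrite exprSr IH -{2}(subrK 1 g) mulrDr mulr1 mulrDl mul1r mulrnAl NN mul0rn.
  by rewrite addr0 mulrS addrCA.
move: (gE k); rewrite gk -[LHS]addr0 => /addrI /esym /matrixP E.
apply/eqP/matrixP => i j; move: (E i j); rewrite mulmxnE [X in _ = X -> _]mxE => /eqP.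
by rewrite mulrn_eq0 -leqn0 leqNgt k0 => /eqP ->; rewrite mxE.
Qed.

Lemma det1_invariant_kernel (R : numFieldType) (Theta : 'M[R]_3)
    (g : 'M[int]_3) (k : nat) :
  Theta^T = - Theta -> (map_mx intr g)^T *m Theta *m map_mx intr g = Theta ->
  \det g = 1 -> (0 < k)%N -> g ^+ k = 1 -> g <> 1 ->
  exists2 p : 'cV[int]_3, p <> 0 & Theta *m map_mx intr p = 0.
Proof.
move=> /skew_crossmx[w ->] inv detg k0 gk g1.
pose gR : 'M[R]_3 := map_mx intr g.
have detgR : \det gR = 1 by rewrite det_map_mx detg.
have gw : gR *m w = w.
  apply: crossmx_inj.
  have gRu : gR \in unitmx by rewrite unitmxE detgR unitr1.
  have gRTu : gR^T \in unitmx by rewrite unitmx_tr.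
  (* Conjugating by [gR] sends both cross product matrices to [crossmx w]. *)
  apply: (can_inj (mulKmx gRTu)); apply: (can_inj (mulmxK gRu)).
  by rewrite crossmx_conj detgR scale1r inv.
pose M := g - 1; pose r i := (row i M)^T.
have Mw i : (map_mx intr (r i))^T *m w = 0.
  rewrite /r -map_trmx trmxK map_row -row_mul map_mxB map_mx1 mulmxBl gw mul1mx.
  by rewrite subrr row0.
have [/'exists_existsP[i [j rij]] | rr0] :=
  boolP [exists i, exists j, crossmx (r i) *m r j != 0].
  exists (crossmx (r i) *m r j); first exact/eqP.
  by rewrite map_mxM map_crossmx crossmx_triple !Mw mxE !scale0r subrr.
case: g1.
(* All rows of [g - 1] are now parallel. *)
have M0 i j k' l : M i k' * M j l = M i l * M j k'.
  have /crossmx_eq0/(_ k' l) : crossmx (r i) *m r j = 0.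
    apply/eqP; apply: contraNT rr0 => rij.
    by apply/existsP; exists i; apply/existsP; exists j.
  by rewrite !mxE.
apply: (unipotent_finite_order k0 gk).
have trM : \tr M = 0.
  by apply/(addrI 1); rewrite -(minors0_det M0) addrC subrK detg addr0.
by rewrite -/M -[M * M]/(M *m M) (minors0_sqr M0) trM scale0r.
Qed.

(** Otherwise cancellation makes the powers of [g] pairwise distinct, too many for [G]. *)
Lemma finite_order_exists (n : nat) (G : set 'M[int]_n.+1) (g : 'M[int]_n.+1) :
  finite_set G -> (forall k : nat, G (g ^+ k)) -> g \is a GRing.unit ->
  exists2 k, (0 < k)%N & g ^+ k = 1.
Proof.
move=> finG Gg gu; apply: contrapT => nk.
have inj : injective (fun k : nat => g ^+ k).
  suff H i j : (i <= j)%N -> g ^+ i = g ^+ j -> i = j.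
    move=> i j; case/orP: (leq_total i j) => [/H//|/H E /esym /E //].
  rewrite leq_eqVlt => /predU1P[//|ij] gij; case: nk; exists (j - i)%N.
    by rewrite subn_gt0.
  apply: (mulrI (unitrX i gu)); rewrite mulr1 -exprD subnKC //; exact: ltnW.
have := finite_preimage (f := fun k : nat => g ^+ k) (B := G) (in2W inj) finG.
rewrite (_ : _ @^-1` _ = setT); first exact: infinite_nat.
by apply/seteqP; split => // k _; exact: Gg.
Qed.

(** * From a generator to the group and its action *)

Theorem theorem1p4 (R : realType) (Theta : 'M[R]_3)
    (Theta_skew : Theta^T = - Theta)
    (A : cstarAlgType R) (u : 'I_3 -> A)
    (A_torus : is_nc_torus Theta u)
    (A_simple : simple_cstar A)
    (G : set 'M[int]_3)
    (G_sub : subgroup_of (G_Theta Theta) G)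
    (G_finite : finite_set G)
    (G_cyclic : cyclic_group G)
    (G_nontrivial : G <> [set 1%:M]) :
  G = [set 1%:M; - 1%:M] /\
  (forall (l : 'cV[int]_3 -> A) (alpha : 'M[int]_3 -> {lrmorphism A -> A}),
     canonical_unitaries Theta u l -> canonical_action G l alpha ->
     forall i, alpha (- 1%:M) (u i) = star (u i)).
Proof.
have [GH G1 GM GV] := G_sub.
have det1_trivial (h : 'M[int]_3) k : \det h = 1 -> (0 < k)%N -> h ^+ k = 1 ->
    (map_mx intr h)^T *m Theta *m map_mx intr h = Theta -> h = 1.
  move=> deth k0 hk hinv; apply: contrapT => h1.
  have [p p0 Tp] := det1_invariant_kernel Theta_skew hinv deth k0 hk h1.
  exact: p0 (simple_nc_torus_nondegenerate Theta_skew A_torus A_simple Tp).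
have [g Gg gG] := G_cyclic.
have [gu ginv] := GH _ Gg.
have Ggk k : G (g ^+ k) by elim: k => [//|k IH]; rewrite exprS; exact: GM.
have [k k0 gk] := finite_order_exists G_finite Ggk gu.
have gN1 : g = -1.
  have [dg|dg] : \det g = 1 \/ \det g = -1.
    by have := gu; rewrite unitmxE => /orP[]/eqP ->; [left|right].
    have g1 := det1_trivial g k dg k0 gk ginv.
    case: G_nontrivial; apply/seteqP; split=> [h /gG[m]|h ->//] /=.
    by rewrite g1 (_ : invmx 1 = 1) ?expr1n => [[]|] //; exact: invr1.
  (* In odd dimension [- g] has determinant 1; the doubled exponent absorbs the sign. *)
  apply: oppr_inj; rewrite opprK; apply: (det1_trivial _ k.*2) => //.
  - by rewrite -scaleN1r detZ dg.
  - by rewrite double_gt0.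
  - by rewrite -mul2n exprM sqrrN -exprM mulnC exprM gk expr1n.
  - by rewrite map_mxN [(- _)^T]raddfN /= mulNmx mulNmx mulmxN opprK.
have GE : G = [set 1%:M; - 1%:M].
  apply/seteqP; split=> [h /gG[m]|h [->|->] //=]; last by rewrite -[- _]gN1.
  rewrite /= gN1 (_ : invmx (-1) = -1); last exact: invrN1.
  rewrite -signr_odd; case: (odd m) => [[]->|[]->]; by [left|right].
split=> // l alpha cl [_ _ _ alphal] i.
have [_ _ lu] := cl.
rewrite -lu alphal; last by rewrite GE; right.
by rewrite mulNmx mul1mx (canonical_unitaryN _ Theta_skew cl).
Qed.
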